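(* Let $d\ge2$ and let $c_1,\dots,c_d>0$. There exists an injective positive trace-one operator $Q$ on the full Fock space $\mathcal F_d$ with $\vartheta_{Q^{1/2}}(S_i)\le c_i$ for all $i$ if and only if $$s_c:=\sum_{i=1}^dc_i^{-2}<1.$$ If in addition $\langle Q\Omega,\Omega\rangle\ge a$ is required, where $0<a<1$, the condition is $s_c\le1-a$. Both conclusions are realized by $$Q_ce_w=(1-s_c)c_w^{-2}e_w,\qquad c_w=\prod_{j=1}^{|w|}c_{i_j}\ (w=i_1\cdots i_{|w|}),\qquad c_\varnothing=1.$$ For $R=Q_c^{1/2}$, $$\Theta_R(S_i)=c_iS_i,\qquad\Theta_R(S_i^* )=c_i^{-1}S_i^*,\qquad\Lambda_R(S_i)=c_i.$$
   Context: $\mathcal F_d=\bigoplus_{n\ge0}(\mathbb C^d)^{\otimes n}$ with orthonormal basis $(e_w)$ indexed by words $w$ in $\{1,\dots,d\}$; $S_ie_w=e_{iw}$ are the left creation operators and $\Omega=e_\varnothing$. For an injective positive Hilbert--Schmidt operator $R$ and bounded $B$: $\vartheta_R(B)=\inf\{c\ge0:BR^2B^*\le c^2R^2\}$ (infinite if no such $c$). When $\vartheta_R(B)<\infty$, $\Theta_R(B)=C_B$ is the unique bounded operator with $BR=RC_B$. $\Lambda_R(B)=\max(\|B\|,\vartheta_R(B),\vartheta_R(B^* ))$. *)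

(* Defs.v *)
From HB Require Import structures.
From mathcomp Require Import all_boot all_order all_algebra.
From mathcomp Require Import all_classical all_reals all_analysis.
From mathcomp Require Import complex lra.

Set Implicit Arguments.
Unset Strict Implicit.
Unset Printing Implicit Defensive.

Import Order.TTheory GRing.Theory Num.Theory.
Local Open Scope classical_set_scope.
Local Open Scope ring_scope.
Local Open Scope complex_scope.

Section UnorderedSums.
Variables (R : realType) (I : choiceType).
Implicit Types (f g : I -> R).

(* The unordered sum of [f]: positive part minus negative part. Only
   meaningful when [f] is absolutely summable. *)
Definition rsum f : R :=
  fine (\esum_(i in [set: I]) (EFin \o f)^\+ i
        - \esum_(i in [set: I]) (EFin \o f)^\- i)%E.

Definition csum (f : I -> R[i]) : R[i] :=
  rsum (fun i => complex.Re (f i)) +i* rsum (fun i => complex.Im (f i)).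

Definition abs_summable f : Prop := summable [set: I] (EFin \o f).

Lemma abs_summable_le f g :
  (forall i, `|f i| <= g i) -> abs_summable g -> abs_summable f.
Proof.
move=> fg; apply: le_lt_trans; apply: le_esum => i _.
by rewrite /= lee_fin (le_trans (fg i)) ?ler_norm.
Qed.

Lemma abs_summableD f g :
  abs_summable f -> abs_summable g -> abs_summable (fun i => f i + g i).
Proof. by move=> sf sg; exact: (summableD sf sg). Qed.

Lemma abs_summable_ge0 f : (forall i, 0 <= f i) ->
  abs_summable f <-> (\esum_(i in [set: I]) (f i)%:E < +oo)%E.
Proof.
move=> f0; rewrite /abs_summable /summable.
by under eq_esum => i _ do rewrite /= ger0_norm//.
Qed.

Lemma esum_fin_num f : (forall i, 0 <= f i) -> abs_summable f ->
  \esum_(i in [set: I]) (f i)%:E \is a fin_num.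
Proof.
move=> f0 sf; rewrite ge0_fin_numE; last first.
  by apply: esum_ge0 => i _; rewrite lee_fin.
by rewrite -(abs_summable_ge0 f0).
Qed.

Lemma esumZ_ge0 (k : R) f : 0 <= k -> (forall i, 0 <= f i) ->
  (\esum_(i in [set: I]) (k * f i)%:E
   = k%:E * \esum_(i in [set: I]) (f i)%:E)%E.
Proof.
have half (l : R) g : 0 <= l -> (forall i, 0 <= g i) ->
    (\esum_(i in [set: I]) (l * g i)%:E
     <= l%:E * \esum_(i in [set: I]) (g i)%:E)%E.
  move=> l0 g0; apply: ge_ereal_sup => _ /= [A [finA _] <-].
  have -> : (\sum_(x \in A) (l * g x)%:E = l%:E * \sum_(x \in A) (g x)%:E)%E.
    by rewrite ge0_mule_fsumr// => i; rewrite lee_fin.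
  apply: lee_pmul => //; first by apply: fsume_ge0 => i _; rewrite lee_fin.
  by apply: ereal_sup_ubound; exists A => //; split.
move=> k0 f0; apply/eqP; rewrite eq_le half//=.
have [->|kn0] := eqVneq k 0.
  by rewrite mul0e; apply: esum_ge0 => i _; rewrite mul0r.
have := half k^-1 (fun i => k * f i).
rewrite invr_ge0 => /(_ k0 (fun i => mulr_ge0 k0 (f0 i))).
under eq_esum => i _ do rewrite mulKf//.
move=> /(lee_wpmul2l (x := k%:E)); rewrite lee_fin => /(_ k0).
by rewrite muleA -EFinM divff// mul1e.
Qed.

Lemma rsumB_ge0 f g : (forall i, 0 <= f i) -> (forall i, 0 <= g i) ->
  abs_summable f -> abs_summable g ->
  rsum (fun i => f i - g i)
  = fine (\esum_(i in [set: I]) (f i)%:E) - fine (\esum_(i in [set: I]) (g i)%:E).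
Proof.
move=> f0 g0 sf sg.
have := esumB sf sg (fun i _ => f0 i) (fun i _ => g0 i).
rewrite /rsum /= => ->; rewrite fineB//.
  exact: esum_fin_num.
exact: esum_fin_num.
Qed.

Lemma rsum_ge0E f : (forall i, 0 <= f i) -> abs_summable f ->
  rsum f = fine (\esum_(i in [set: I]) (f i)%:E).
Proof.
move=> f0 sf; have s0 : abs_summable (fun=> 0 : R).
  by apply: abs_summable_le sf => i; rewrite normr0.
have := rsumB_ge0 f0 (fun=> lexx _) sf s0.
have -> : (\esum_(i in [set: I]) (0 : R)%:E)%E = 0%E by apply: esum1.
by rewrite subr0 => <-; congr rsum; apply/funext => i; rewrite subr0.
Qed.

Lemma abs_summableZ (k : R) f :
  abs_summable f -> abs_summable (fun i => k * f i).
Proof.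
move=> sf; apply: (@abs_summable_le _ (fun i => `|k| * `|f i|)) => [i|].
  by rewrite normrM.
rewrite abs_summable_ge0 => [|i]; last exact: mulr_ge0.
rewrite esumZ_ge0//; move: sf; rewrite /abs_summable /summable /= => sf.
by rewrite lte_mul_pinfty.
Qed.

Lemma abs_summable_split f : abs_summable f -> exists g h,
  [/\ forall i, 0 <= g i, forall i, 0 <= h i, abs_summable g, abs_summable h
    & forall i, f i = g i - h i].
Proof.
move=> sf; exists (fun i => `|f i|), (fun i => `|f i| - f i).
have sa : abs_summable (fun i => `|f i|) by rewrite abs_summable_ge0.
split=> [i|i|//||i]; [by []|by rewrite subr_ge0 ler_norm| |by lra].
apply: abs_summableD => //; apply: abs_summable_le sa => i.
by rewrite normrN.
Qed.

Lemma rsum_eqB f g h : (forall i, 0 <= g i) -> (forall i, 0 <= h i) ->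
  abs_summable g -> abs_summable h -> (forall i, f i = g i - h i) ->
  rsum f
  = fine (\esum_(i in [set: I]) (g i)%:E) - fine (\esum_(i in [set: I]) (h i)%:E).
Proof. by move=> g0 h0 sg sh /funext ->; exact: rsumB_ge0. Qed.

Lemma rsumD f f' : abs_summable f -> abs_summable f' ->
  rsum (fun i => f i + f' i) = rsum f + rsum f'.
Proof.
move=> /abs_summable_split[g [h [g0 h0 sg sh fE]]].
move=> /abs_summable_split[g' [h' [g'0 h'0 sg' sh' f'E]]].
rewrite (rsum_eqB g0 h0 sg sh fE) (rsum_eqB g'0 h'0 sg' sh' f'E).
rewrite (@rsum_eqB _ (fun i => g i + g' i) (fun i => h i + h' i)); first last.
- by move=> i; rewrite fE f'E; lra.
- exact: abs_summableD.
- exact: abs_summableD.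
- by move=> i; exact: addr_ge0.
- by move=> i; exact: addr_ge0.
have D k k' : abs_summable k -> abs_summable k' ->
   (forall i, 0 <= k i) -> (forall i, 0 <= k' i) ->
   fine (\esum_(i in [set: I]) (k i + k' i)%:E)
   = fine (\esum_(i in [set: I]) (k i)%:E)
     + fine (\esum_(i in [set: I]) (k' i)%:E).
  move=> sk sk' k0 k'0.
  rewrite -fineD; [|exact: esum_fin_num..]; congr fine.
  by rewrite -esumD// => i _; rewrite lee_fin.
by rewrite (D g g')// (D h h')//; lra.
Qed.

Lemma rsumN f : abs_summable f -> rsum (fun i => - f i) = - rsum f.
Proof.
move=> /abs_summable_split[g [h [g0 h0 sg sh fE]]].
rewrite (rsum_eqB g0 h0 sg sh fE) (@rsum_eqB _ h g)// => [|i]; first lra.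
by rewrite fE; lra.
Qed.

Lemma rsumZ (k : R) f : abs_summable f -> rsum (fun i => k * f i) = k * rsum f.
Proof.
have P (l : R) f' : 0 <= l -> abs_summable f' ->
    rsum (fun i => l * f' i) = l * rsum f'.
  move=> l0 /abs_summable_split[g [h [g0 h0 sg sh fE]]].
  rewrite (rsum_eqB g0 h0 sg sh fE).
  rewrite (@rsum_eqB _ (fun i => l * g i) (fun i => l * h i)); first last.
  - by move=> i; rewrite fE mulrBr.
  - exact: abs_summableZ.
  - exact: abs_summableZ.
  - by move=> i; exact: mulr_ge0.
  - by move=> i; exact: mulr_ge0.
  by rewrite !esumZ_ge0// !fineM ?mulrBr//; exact: esum_fin_num.
move=> sf; have [k0|k0] := leP 0 k; first exact: P.
have -> : (fun i => k * f i) = (fun i => - (- k * f i)).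
  by apply/funext => i; rewrite mulNr opprK.
rewrite rsumN; last exact: abs_summableZ.
by rewrite P ?mulNr ?opprK// oppr_ge0 ltW.
Qed.

Lemma rsum_supp1 f j : (forall i, i != j -> f i = 0) -> rsum f = f j.
Proof.
move=> f0; have supp1 (a : I -> \bar R) : (forall i, i != j -> a i = 0%E) ->
    (0 <= a j)%E -> (\esum_(i in [set: I]) a i = a j)%E.
  move=> a0 aj; rewrite -[RHS](@esum_set1 _ _ j a)// [RHS]esum_mkcond.
  by apply: eq_esum => i _; rewrite in_set1; case: eqP => // /eqP /a0.
rewrite /rsum !supp1 ?funepos_ge0 ?funeneg_ge0//.
- have := funeposneg (EFin \o f); move/(congr1 (@^~ j)) => /= <-.
  by [].
- by move=> i /f0 fi; rewrite funenegE /= fi oppr0 maxxx.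
- by move=> i /f0 fi; rewrite funeposE /= fi maxxx.
Qed.

End UnorderedSums.

Section ComplexSums.
Variables (R : realType) (I : choiceType).
Implicit Types (f g : I -> R[i]).

Definition cabs_summable f : Prop :=
  abs_summable (fun i => complex.Re (f i)) /\
  abs_summable (fun i => complex.Im (f i)).

Let complexP (z t : R[i]) :
  complex.Re z = complex.Re t -> complex.Im z = complex.Im t -> z = t.
Proof. by case: z t => a b [c d] /= -> ->. Qed.

Lemma csumD f g : cabs_summable f -> cabs_summable g ->
  csum (fun i => f i + g i) = csum f + csum g.
Proof.
move=> [f1 f2] [g1 g2]; apply: complexP; rewrite /csum /= -rsumD//;
  by congr rsum; apply/funext => i; case: (f i) (g i) => ? ? [].
Qed.

Lemma csumZ (a : R[i]) f : cabs_summable f ->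
  csum (fun i => a * f i) = a * csum f.
Proof.
case: a => a b [f1 f2]; apply: complexP; rewrite /csum /=.
  rewrite -mulNr -!rsumZ// -rsumD; [|exact: abs_summableZ..].
  by congr rsum; apply/funext => i; case: (f i) => ? ? /=; rewrite mulNr.
rewrite -!rsumZ// -rsumD; [|exact: abs_summableZ..].
by congr rsum; apply/funext => i; case: (f i).
Qed.

Lemma csum_conj f : cabs_summable f ->
  csum (fun i => (f i)^*%C) = (csum f)^*%C.
Proof.
move=> [f1 f2]; apply: complexP; rewrite /csum /= -?rsumN//;
  by congr rsum; apply/funext => i; case: (f i).
Qed.

End ComplexSums.

Section SquareSummable.
Variables (R : realType) (I : choiceType).

Definition sqmod (z : R[i]) : R := complex.Re z ^+ 2 + complex.Im z ^+ 2.

Lemma sqmodE (z : R[i]) : (sqmod z)%:C = `|z| ^+ 2.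
Proof. by rewrite add_Re2_Im2. Qed.

Lemma sqmod_ge0 (z : R[i]) : 0 <= sqmod z.
Proof. by rewrite addr_ge0 ?sqr_ge0. Qed.

Lemma sqmodM (z t : R[i]) : sqmod (z * t) = sqmod z * sqmod t.
Proof. by case: z t => a b [c d]; rewrite /sqmod /=; lra. Qed.

Lemma sqmodD (z t : R[i]) : sqmod (z + t) <= 2 * sqmod z + 2 * sqmod t.
Proof.
case: z t => a b [c d]; rewrite /sqmod /=.
by have := sqr_ge0 (a - c); have := sqr_ge0 (b - d); lra.
Qed.

Lemma sqmod_eq0 (z : R[i]) : sqmod z = 0 -> z = 0.
Proof.
case: z => a b /eqP; rewrite /sqmod /= paddr_eq0 ?sqr_ge0// !sqrf_eq0.
by case/andP=> /eqP-> /eqP->.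
Qed.

(* The Hilbert space l^2(I) of square-summable families of complex numbers. *)
Definition l2_pred : {pred I -> R[i]} :=
  fun f => (\esum_(i in [set: I]) (sqmod (f i))%:E < +oo)%E.

Lemma in_l2_pred (f : I -> R[i]) :
  (f \in l2_pred) = (\esum_(i in [set: I]) (sqmod (f i))%:E < +oo)%E.
Proof. by []. Qed.

Lemma l2_predE (f : I -> R[i]) :
  f \in l2_pred <-> abs_summable (fun i => sqmod (f i)).
Proof. by rewrite abs_summable_ge0 // => i; exact: sqmod_ge0. Qed.

Fact l2_submod_closed : submod_closed l2_pred.
Proof.
split=> [|a f g /l2_predE sf /l2_predE sg]; apply/l2_predE.
  rewrite abs_summable_ge0 => [|i]; last exact: sqmod_ge0.
  by rewrite esum1 ?ltry// => i _; rewrite /sqmod /= expr0n /= addr0.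
apply: (@abs_summable_le _ _ _
    (fun i => (2 * sqmod a) * sqmod (f i) + 2 * sqmod (g i))) => [i|].
  rewrite ger0_norm ?sqmod_ge0//= (le_trans (sqmodD _ _))//.
  by rewrite -[(a *: f) i]/(a * f i) sqmodM mulrA.
by apply: abs_summableD; exact: abs_summableZ.
Qed.

HB.instance Definition _ :=
  GRing.isSubmodClosed.Build R[i] (I -> R[i]) l2_pred l2_submod_closed.

Record l2 : Type := L2 { l2fun :> I -> R[i]; l2P : l2fun \in l2_pred }.

HB.instance Definition _ := [isSub for l2fun].
HB.instance Definition _ := [Choice of l2 by <:].
HB.instance Definition _ := [SubChoice_isSubLmodule of l2 by <:].

Implicit Types x y : l2.

Definition dot x y : R[i] := csum (fun i => x i * (y i)^*%C).

Lemma dot_summable x y : cabs_summable (fun i => x i * (y i)^*%C).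
Proof.
have sx := (l2_predE _).1 (l2P x); have sy := (l2_predE _).1 (l2P y).
split; apply: abs_summable_le (abs_summableD sx sy) => i;
  case: (x i) (y i) => a b [c d]; rewrite /sqmod /=; rewrite ler_norml;
  have := sqr_ge0 (a - c); have := sqr_ge0 (b - d);
  have := sqr_ge0 (a + c); have := sqr_ge0 (b + d);
  have := sqr_ge0 (a + d); have := sqr_ge0 (b + c);
  have := sqr_ge0 (a - d); have := sqr_ge0 (b - c); lra.
Qed.

Lemma dot_conj x y : dot x y = (dot y x)^*%C.
Proof.
rewrite /dot -csum_conj; last exact: dot_summable.
by congr csum; apply/funext => i; rewrite rmorphM /= conjcK mulrC.
Qed.

Lemma dotDl x x' y : dot (x + x') y = dot x y + dot x' y.
Proof.
rewrite /dot -csumD; [|exact: dot_summable..].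
by congr csum; apply/funext => i; rewrite -mulrDl.
Qed.

Lemma dotZl a x y : dot (a *: x) y = a * dot x y.
Proof.
rewrite /dot -csumZ; last exact: dot_summable.
by congr csum; apply/funext => i; rewrite mulrA.
Qed.

Lemma dot_selfE x : dot x x = (rsum (fun i => sqmod (x i)))%:C.
Proof.
rewrite /dot /csum -[RHS]/(_ +i* _); congr (_ +i* _).
  by congr rsum; apply/funext => i; case: (x i) => a b; rewrite /sqmod /=; lra.
have -> : (fun i => complex.Im (x i * (x i)^*%C)) = (fun i => 0 * 0 : R).
  by apply/funext => i; case: (x i) => a b /=; lra.
rewrite rsumZ ?mul0r//; rewrite abs_summable_ge0//.
by rewrite esum1 ?ltry.
Qed.

Lemma dot_gt0 x : x != 0 -> 0 < dot x x.
Proof.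
move=> xn0; have [i xi] : exists i, x i != 0.
  apply: contrapT => /forallNP x0; case/eqP: xn0.
  apply: val_inj; apply/funext => i; apply/eqP.
  by have /negP := x0 i; rewrite negbK.
have sx := (l2_predE _).1 (l2P x).
have x0 j : 0 <= sqmod (x j) by exact: sqmod_ge0.
rewrite dot_selfE ltcR rsum_ge0E// fine_gt0//; apply/andP; split.
  apply: (@lt_le_trans _ _ (sqmod (x i))%:E).
    rewrite lte_fin lt_neqAle x0 andbT eq_sym.
    by apply: contraNneq xi => /sqmod_eq0 ->.
  rewrite -(@esum_set1 _ _ i (fun j => (sqmod (x j))%:E)) ?lee_fin//.
  apply: ereal_sup_le => _ /= [A [finA _] <-].
  by exists A.
by rewrite -abs_summable_ge0.
Qed.

Fact dot_bilinear : bilinear_for *%R (Num.conj \; *%R) dot.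
Proof.
split=> [y a x x'|x a y y'] /=; first by rewrite dotDl dotZl.
by rewrite [LHS]dot_conj dotDl dotZl rmorphD rmorphM /= (dot_conj x y) (dot_conj x y').
Qed.

HB.instance Definition _ := bilinear_isBilinear.Build R[i] l2 l2 R[i]
  *%R (Num.conj \; *%R) dot dot_bilinear.

Fact dot_hermitian x y : dot x y = (-1) ^+ false * Num.conj (dot y x).
Proof. by rewrite expr0 mul1r dot_conj. Qed.

HB.instance Definition _ := isHermitianSesquilinear.Build R[i] l2
  false Num.conj dot dot_hermitian.
HB.instance Definition _ := isDotProduct.Build R[i] l2 dot dot_gt0.

Definition l2norm x : R := Num.sqrt (complex.Re (dot x x)).

Definition delta (j i : I) : R[i] := (i == j)%:R.

Fact delta_l2 j : delta j \in l2_pred.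
Proof.
rewrite in_l2_pred.
rewrite (eq_esum (b := fun i => if i \in [set j] then 1%:E else 0%E)).
  by rewrite -(esum_mkcond [set j] (fun=> 1%:E)) esum_set1 ?ltry.
move=> i _; rewrite in_set1 /sqmod /delta; case: eqP => _ /=.
  by rewrite expr1n expr0n addr0.
by rewrite expr0n addr0.
Qed.

Definition ebasis (j : I) : l2 := L2 (delta_l2 j).

Lemma dot_ebasis x (j : I) : dot x (ebasis j) = x j.
Proof.
rewrite /dot /csum; case E : (x j) => [a b]; congr (_ +i* _).
  rewrite (rsum_supp1 (j := j)) => [|i /negPf ij].
    by rewrite E /= /delta eqxx /=; lra.
  by rewrite /= /delta ij; case: (x i) => ? ? /=; lra.
rewrite (rsum_supp1 (j := j)) => [|i /negPf ij].
  by rewrite E /= /delta eqxx /=; lra.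
by rewrite /= /delta ij; case: (x i) => ? ? /=; lra.
Qed.

End SquareSummable.

Section Operators.
Variables (R : realType) (I : choiceType).
Local Notation H := (l2 R I).
Implicit Types (A B C Q T : H -> H) (x y : H).

Definition bounded_op T : Prop :=
  linear T /\ exists M : R, forall x, l2norm (T x) <= M * l2norm x.

Definition opnorm T : \bar R :=
  ereal_sup [set (l2norm (T x))%:E | x in [set x | l2norm x <= 1]].

(* The adjoint B^*, unique when it exists; it exists for every bounded B. *)
Definition adj B : H -> H :=
  xget (fun=> 0) [set B' | bounded_op B' /\ forall x y, dot (B x) y = dot x (B' y)].

(* The order of R[i] makes [0 <= z] mean that z is real and nonnegative. *)
Definition positive_op T : Prop := forall x, 0 <= dot (T x) x.

Definition op_le A B : Prop := positive_op (fun x => B x - A x).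

(* The trace of a positive operator, computed in the basis [ebasis]; for
   positive operators it does not depend on the orthonormal basis. *)
Definition trace T : \bar R :=
  \esum_(j in [set: I]) (complex.Re (dot (T (ebasis R j)) (ebasis R j)))%:E.

(* T = Q^{1/2}: a positive bounded operator has exactly one positive bounded
   square root. *)
Definition positive_sqrt_of Q T : Prop :=
  [/\ bounded_op T, positive_op T & T \o T = Q].

(* The infimum of the empty set is +oo in \bar R. *)
Definition vartheta T B : \bar R :=
  ereal_inf [set c%:E | c in [set c : R | 0 <= c /\
    op_le (B \o (T \o T) \o adj B) (fun x => (c ^+ 2)%:C *: (T \o T) x)]].

(* At most one C qualifies when T is injective. *)
Definition Theta T B : H -> H :=
  xget (fun=> 0) [set C | bounded_op C /\ B \o T = T \o C].

Definition Lambda T B : \bar R :=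
  maxe (opnorm B) (maxe (vartheta T B) (vartheta T (adj B))).

Definition injective_density Q : Prop :=
  [/\ bounded_op Q, injective Q, positive_op Q & trace Q = 1%E].

End Operators.

Section Fock.
Variables (R : realType) (d : nat).

(* The words of length n index the product basis of the n-th tensor power of
   C^d, so in coordinates along (e_w) the Hilbert sum of the tensor powers is
   l^2 of the set of all words. *)
Definition fock := l2 R (seq 'I_d).

Definition word_prod (c : 'I_d -> R) (w : seq 'I_d) : R := \prod_(j <- w) c j.

Definition vacuum : fock := ebasis R ([::] : seq 'I_d).

(* S_i x has coordinate x_v at the word iv, and 0 at the words that do not
   start with i. *)
Definition creation_fun (i : 'I_d) (x : fock) (w : seq 'I_d) : R[i] :=
  if w is j :: v then if j == i then x v else 0 else 0.

Fact creation_l2 i x : creation_fun i x \in @l2_pred R (seq 'I_d).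
Proof.
rewrite in_l2_pred; have := l2P x; rewrite in_l2_pred; apply: le_lt_trans.
have inj : set_inj [set: seq 'I_d] (cons i) by move=> v w _ _ [].
rewrite (eq_esum (b := fun w => if w \in [set i :: v | v in [set: seq 'I_d]]
    then (sqmod (creation_fun i x w))%:E else 0%E)); last first.
  move=> w _; case: ifPn => // /negP wi; congr EFin.
  suff -> : creation_fun i x w = 0 by rewrite /sqmod /= expr0n addr0.
  case: w wi => [//|j v] wi /=; case: eqP => // ji; case: wi.
  by rewrite inE; exists v; rewrite // ji.
rewrite -esum_mkcond
  (esum_image _ _ (fun w => (sqmod (creation_fun i x w))%:E) inj).
by apply: le_esum => v _ /=; rewrite eqxx.
Qed.

Definition creation (i : 'I_d) (x : fock) : fock := L2 (creation_l2 i x).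

Lemma creation_ebasis i w :
  creation i (ebasis R w) = ebasis R (i :: w).
Proof.
apply: val_inj; apply/funext => -[|j v] //=.
by rewrite /delta eqseq_cons; case: eqP.
Qed.

End Fock.

(* Main.v *)
Require Import Defs.
From HB Require Import structures.
From mathcomp Require Import all_boot all_order all_algebra.
From mathcomp Require Import all_classical all_reals all_analysis.
From mathcomp Require Import complex ring lra.

Set Implicit Arguments.
Unset Strict Implicit.
Unset Printing Implicit Defensive.

Import Order.TTheory GRing.Theory Num.Theory.
Local Open Scope classical_set_scope.
Local Open Scope ring_scope.
Local Open Scope complex_scope.

(** Everything rests on rewriting the condition on [vartheta] as a norm
    inequality. A positive operator on a complex space is Hermitian
    ([positive_op_selfadjoint]), so [B T^2 B^* <= c^2 T^2] says
    [|T B^* x| <= c |T x|] for all [x], and the infimum defining [vartheta] is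
    attained ([vartheta_leP]).

    Necessity. Put [p w = |T e_w|^2], the diagonal of [Q = T^2]. For [B = S_i] and
    [x = e_(iw)] the inequality gives [p (iw) >= c_i^-2 p w]. Splitting the trace
    [sum_w p w = 1] by the first letter ([esum_words]) gives
    [1 >= p [] + s * 1], that is [s <= 1 - <Q Omega, Omega>] ([weight_sum_le]).
    The vacuum weight is positive because [Q] is injective ([sqrt_vacuum_gt0]), so
    [s < 1]; a lower bound [a] on it gives [s <= 1 - a].

    Sufficiency. When [s < 1], take for [T] the diagonal operator with weights
    [sqrt (1 - s) / c_w]. The trace of [T^2] is a geometric sum over words
    ([esum_word_prod]), equal to [1], and its vacuum weight is [1 - s]. Since each
    further letter [i] divides the weight by [c_i], [T] commutes with [S_i] and
    [S_i^*] up to the scalars [c_i^-1] and [c_i]. This gives [Theta], and, with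
    [c_i >= 1], that [vartheta] of [S_i] dominates both the norm of [S_i] and
    [vartheta] of [S_i^*] in [Lambda]. *)

(** * Unordered sums *)

Section SumReindexing.
Variables (R : realType) (I J : choiceType) (e : J -> I).
Hypothesis inje : injective e.

Lemma esum_reindex (f : I -> \bar R) :
    (forall i, (forall j, i != e j) -> f i = 0%E) ->
  (\esum_(i in [set: I]) f i = \esum_(j in [set: J]) f (e j))%E.
Proof.
move=> f0; rewrite -(esum_image _ _ f (fun x y _ _ => @inje x y)).
rewrite [RHS]esum_mkcond; apply: eq_esum => i _.
case: ifPn => // /negP ni; apply: f0 => j; apply: contra_not_neq ni => ->.
by rewrite inE; exists j.
Qed.

Lemma rsum_reindex (f : I -> R) :
    (forall i, (forall j, i != e j) -> f i = 0) ->
  rsum f = rsum (f \o e).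
Proof.
move=> f0; rewrite /rsum [X in (X - _)%E]esum_reindex; last first.
  by move=> i /f0 fi; rewrite funeposE /= fi maxxx.
rewrite [X in (_ - X)%E]esum_reindex; last first.
  by move=> i /f0 fi; rewrite funenegE /= fi oppr0 maxxx.
congr fine; congr (_ - _)%E; apply: eq_esum => j _.
  by rewrite !funeposE.
by rewrite !funenegE.
Qed.

Lemma csum_reindex (f : I -> R[i]) :
    (forall i, (forall j, i != e j) -> f i = 0) ->
  csum f = csum (f \o e).
Proof. by move=> f0; rewrite /csum !rsum_reindex// => i /f0 ->. Qed.

End SumReindexing.

Section WordSums.
Variables (R : realType) (d : nat).
Local Notation words := [set: seq 'I_d].

Lemma esum_words (f : seq 'I_d -> \bar R) : (forall w, 0 <= f w)%E ->
  (\esum_(w in words) f w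
   = f [::] + \sum_(i < d) \esum_(w in words) f (i :: w))%E.
Proof.
move=> f0.
(* [g i] is [f] cut down to the words with first letter [i]. *)
pose g i (w : seq 'I_d) := if w is j :: v then (if j == i then f w else 0%E) else 0%E.
have g0 i w : (0 <= g i w)%E by case: w => //= j v; case: ifP.
have {1}-> : \esum_(w in words) f w
    = (\esum_(w in words) ((if w \in [set [::]] then f [::] else 0)
                           + \sum_(i < d) g i w))%E.
  apply: eq_esum => -[|j v] _; rewrite in_set1 /=.
    by rewrite big1 ?adde0.
  by rewrite add0e (bigD1 j)//= eqxx big1 ?adde0// => i /negPf; rewrite eq_sym => ->.
rewrite esumD; first last.
- by move=> w _; exact: sume_ge0.
- by move=> w _; case: ifP.
rewrite -(esum_mkcond [set [::]] (fun=> f [::])) esum_set1// esum_sum//.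
congr (_ + _)%E; apply: eq_bigr => i _.
rewrite (@esum_reindex _ _ _ (cons i)).
- by apply: eq_esum => w _ /=; rewrite eqxx.
- by move=> v w [].
- move=> [|j v] //= nji; case: eqP => // ji.
  by have := nji v; rewrite ji eqxx.
Qed.

(** The sum over words of length less than [n] obeys [E_(n+1) = 1 + r E_n], with
    [r] the sum of the weights, and so stays below the fixed point
    [1 / (1 - r)]; once the full sum is known to be finite, the same recursion
    identifies it with that fixed point. *)
Lemma esum_word_prod (r : 'I_d -> R) : (forall i, 0 <= r i) ->
    \sum_(i < d) r i < 1 ->
  (\esum_(w in words) (word_prod r w)%:E = ((1 - \sum_(i < d) r i)^-1)%:E)%E.
Proof.
move=> r0; set s := \sum_(i < d) r i => s1.
have s0 : 0 <= s by exact: sumr_ge0.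
have p0 w : 0 <= word_prod r w by exact: prodr_ge0.
have step (f : seq 'I_d -> R) : (forall w, 0 <= f w) ->
    (\sum_(i < d) \esum_(w in words) (r i * f w)%:E
     = s%:E * \esum_(w in words) (f w)%:E)%E.
  move=> f0; rewrite /s -sumEFin ge0_sume_distrl => [|i _]; last by rewrite lee_fin.
  by apply: eq_bigr => i _; rewrite esumZ_ge0.
pose t n w : R := if (size w < n)%N then word_prod r w else 0.
have t0 n w : 0 <= t n w by rewrite /t; case: ifP.
have trunc n : (\esum_(w in words) (t n w)%:E <= ((1 - s)^-1)%:E)%E.
  elim: n => [|n IHn].
    by rewrite esum1// lee_fin invr_ge0 subr_ge0 ltW.
  rewrite esum_words => [|w]; last by rewrite lee_fin.
  rewrite [X in (_ + X)%E](_ : _ = s%:E * \esum_(w in words) (t n w)%:E)%E.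
    apply: (@le_trans _ _ (1%:E + s%:E * ((1 - s)^-1)%:E)%E).
      apply: leeD; first by rewrite /t /= /word_prod big_nil.
      by apply: lee_wpmul2l; rewrite ?lee_fin.
    have s1n0 : 1 - s != 0 by lra.
    by rewrite -EFinM -EFinD lee_fin le_eqVlt; apply/orP; left; apply/eqP; field.
  rewrite -step//; apply: eq_bigr => i _; apply: eq_esum => w _; congr EFin.
  by rewrite /t /= ltnS; case: ifP => _; rewrite ?mulr0// /word_prod big_cons.
have fin : (\esum_(w in words) (word_prod r w)%:E <= ((1 - s)^-1)%:E)%E.
  apply: ge_ereal_sup => _ /= [A [finA _] <-].
  pose n := (\max_(w <- finmap.enum_fset (fset_set A)) size w).+1.
  apply: le_trans (trunc n).
  rewrite (_ : (\sum_(w \in A) _ = \sum_(w \in A) (t n w)%:E)%E).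
    by apply: ereal_sup_ubound; exists A.
  rewrite !fsbig_finite//=; apply: eq_big_seq => w wA.
  by rewrite /t ltnS (leq_bigmax_seq w).
have fixed : (\esum_(w in words) (word_prod r w)%:E
    = 1 + s%:E * \esum_(w in words) (word_prod r w)%:E)%E.
  rewrite -step// esum_words => [|w]; last by rewrite lee_fin.
  congr (_ + _)%E; first by rewrite /word_prod big_nil.
  apply: eq_bigr => i _; apply: eq_esum => w _.
  by rewrite /word_prod big_cons.
move: fin fixed; have := @esum_ge0 _ _ words (fun w => (word_prod r w)%:E).
move=> /(_ (fun w _ => p0 w)).
case: (esum _ _) => // x _ _ [xE].
have s1n0 : 1 - s != 0 by lra.
by congr EFin; apply: (mulIf s1n0); rewrite mulVf//; lra.
Qed.

End WordSums.

(** * Norms and adjoints on l^2 *)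

Section Hilbert.
Variables (R : realType) (I : choiceType).
Local Notation H := (l2 R I).
Implicit Types (x y : H) (B T Q : H -> H) (a : R[i]) (c : R).

Lemma l2_ext x y : (forall i, x i = y i) -> x = y.
Proof. by move=> xy; apply: val_inj; apply/funext. Qed.

Lemma l2D x y i : (x + y) i = x i + y i. Proof. by []. Qed.
Lemma l2Z a x i : (a *: x) i = a * x i. Proof. by []. Qed.

Lemma dotDr x y y' : dot x (y + y') = dot x y + dot x y'.
Proof. by rewrite [LHS]dot_conj dotDl rmorphD /= (dot_conj x y) (dot_conj x y'). Qed.

Lemma dotZr a x y : dot x (a *: y) = a^*%C * dot x y.
Proof. by rewrite [LHS]dot_conj dotZl rmorphM /= (dot_conj x y). Qed.

Lemma dotBl x x' y : dot (x - x') y = dot x y - dot x' y.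
Proof. by rewrite -scaleN1r dotDl dotZl mulN1r. Qed.

Lemma sqmodZ c (z : R[i]) : sqmod (c%:C * z) = c ^+ 2 * sqmod z.
Proof. by rewrite sqmodM {1}/sqmod /= expr0n addr0. Qed.

Lemma l2norm_ge0 x : 0 <= l2norm x. Proof. exact: sqrtr_ge0. Qed.

Lemma rsum_sqmod_ge0 x : 0 <= rsum (fun i => sqmod (x i)).
Proof.
have [->|x0] := eqVneq x 0; last first.
  by have := dot_gt0 x0; rewrite dot_selfE ltcR => /ltW.
rewrite rsum_ge0E ?fine_ge0 ?esum_ge0// => [i _||].
- by rewrite lee_fin sqmod_ge0.
- by move=> i; exact: sqmod_ge0.
- exact: (l2_predE _).1 (l2P 0).
Qed.

Lemma l2norm_sqr x : l2norm x ^+ 2 = rsum (fun i => sqmod (x i)).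
Proof. by rewrite /l2norm dot_selfE sqr_sqrtr ?rsum_sqmod_ge0. Qed.

Lemma dot_self x : dot x x = (l2norm x ^+ 2)%:C.
Proof. by rewrite l2norm_sqr dot_selfE. Qed.

Lemma l2norm_gt0 x : x != 0 -> 0 < l2norm x.
Proof.
move=> /dot_gt0; rewrite dot_self ltcR => x2.
rewrite lt_def l2norm_ge0 andbT; apply: contraTneq x2 => ->.
by rewrite expr0n ltxx.
Qed.

Lemma l2norm_le_pointwise x y c : 0 <= c ->
  (forall i, sqmod (x i) <= c ^+ 2 * sqmod (y i)) -> l2norm x <= c * l2norm y.
Proof.
move=> c0 xy; rewrite -(ler_pXn2r (n := 2))// ?nnegrE ?mulr_ge0 ?l2norm_ge0//.
have sl (z : H) : abs_summable (fun i => sqmod (z i)) by exact: (l2_predE _).1 (l2P z).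
rewrite exprMn !l2norm_sqr -rsumZ; last exact: sl.
have p0 (z : H) i : 0 <= sqmod (z i) by exact: sqmod_ge0.
rewrite !rsum_ge0E//; last first.
- exact: abs_summableZ (sl y).
- by move=> i; rewrite mulr_ge0// sqr_ge0.
apply: fine_le.
- exact: esum_fin_num (sl x).
- apply: esum_fin_num; first by move=> i; rewrite mulr_ge0// sqr_ge0.
  exact: abs_summableZ (sl y).
- by apply: le_esum => i _; rewrite lee_fin.
Qed.

Lemma l2normZ c x : l2norm (c%:C *: x) = `|c| * l2norm x.
Proof.
apply/eqP; rewrite -(eqrXn2 (n := 2))// ?mulr_ge0 ?l2norm_ge0//; apply/eqP.
rewrite exprMn !l2norm_sqr -rsumZ; last exact: (l2_predE _).1 (l2P x).
by congr rsum; apply/funext => i; rewrite l2Z sqmodZ real_normK ?num_real.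
Qed.

Lemma l2norm_ebasis i : l2norm (ebasis R (i : I)) = 1.
Proof. by rewrite /l2norm dot_ebasis /= /delta eqxx /= sqrtr1. Qed.

Lemma bounded_opZ c B : bounded_op B -> bounded_op (fun x => c%:C *: B x).
Proof.
move=> [linB [M BM]]; split.
  by move=> a x y; rewrite linB scalerDr !scalerA mulrC.
exists (`|c| * M) => x; rewrite l2normZ -mulrA.
by apply: ler_wpM2l.
Qed.

Lemma bounded_op_comp A B : bounded_op A -> bounded_op B -> bounded_op (A \o B).
Proof.
move=> [linA [M AM]] [linB [N BN]]; split.
  by move=> a x y; rewrite /= linB linA.
exists (`|M| * N) => x; apply: le_trans (AM _) _.
apply: (@le_trans _ _ (`|M| * l2norm (B x))).
  by rewrite ler_wpM2r ?l2norm_ge0// ler_norm.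
by rewrite -mulrA ler_wpM2l.
Qed.

(** Pairing with the basis vectors recovers the coordinates. *)
Lemma dot_injr y y' : (forall x, dot x y = dot x y') -> y = y'.
Proof.
by move=> yy'; apply: l2_ext => i; rewrite -!dot_ebasis dot_conj yy' -dot_conj.
Qed.

Lemma adjE B B' : bounded_op B' -> (forall x y, dot (B x) y = dot x (B' y)) ->
  adj B = B'.
Proof.
move=> bB' BB'; rewrite /adj; case: xgetP => [C _ /= [_ BC]|/(_ B')]; last by case.
by apply/funext => y; apply: dot_injr => x; rewrite -BC BB'.
Qed.

Lemma ThetaE T B C : injective T -> bounded_op C -> (forall x, B (T x) = T (C x)) ->
  Theta T B = C.
Proof.
move=> injT bC BTC; rewrite /Theta; case: xgetP => [D _ /= [_ BTD]|/(_ C)].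
  by apply/funext => x; apply: injT; rewrite -BTC -[B _]/((B \o T) x) BTD.
by case; split=> //; apply/funext => x /=; rewrite BTC.
Qed.

(** Over the complex scalars a positive form is Hermitian, by polarization:
    its values at [x + y] and at [x + 'i y] are real. *)
Lemma positive_op_selfadjoint T : linear T -> positive_op T ->
  forall x y, dot (T x) y = dot x (T y).
Proof.
move=> linT posT x y; rewrite [RHS]dot_conj.
have TD u v : T (u + v) = T u + T v by have := linT 1 u v; rewrite !scale1r.
have TZ a u : T (a *: u) = a *: T u.
  have T0 : T 0 = 0 by have := linT (-1) 0 0; rewrite scaler0 add0r scaleN1r addNr.
  by have := linT a u 0; rewrite T0 !addr0.
have Im0 u : complex.Im (dot (T u) u) = 0 by exact/ger0_Im/posT.
have := Im0 (x + y); have := Im0 (x + 'i%C *: y).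
rewrite !(TD, TZ, dotDl, dotDr, dotZl, dotZr).
have := Im0 x; have := Im0 y.
case: (dot (T x) x) (dot (T y) y) (dot (T x) y) (dot (T y) x)
  => [a b] [a' b'] [u v] [u' v'] /=.
move=> -> -> E1 E2; congr (_ +i* _); lra.
Qed.

(** [B T^2 B^* <= c^2 T^2] compares the quadratic forms [|T B^* x|^2] and
    [c^2 |T x|^2]; the infimum over such [c] is attained because each of these
    inequalities is closed in [c]. *)
Lemma vartheta_leP T B B' c : bounded_op T -> positive_op T ->
    bounded_op B' -> (forall x y, dot (B x) y = dot x (B' y)) -> 0 <= c ->
  (vartheta T B <= c%:E)%E <-> forall x, l2norm (T (B' x)) <= c * l2norm (T x).
Proof.
move=> [linT _] posT bB' BB' c0.
have symT := positive_op_selfadjoint linT posT.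
have formE u : dot (T (T u)) u = (l2norm (T u) ^+ 2)%:C.
  by rewrite symT dot_self.
have formP b : 0 <= b ->
    op_le (B \o (T \o T) \o adj B) (fun x => (b ^+ 2)%:C *: (T \o T) x) <->
    forall x, l2norm (T (B' x)) <= b * l2norm (T x).
  move=> b0; rewrite (adjE bB' BB').
  have sqrE x : (0 <= dot ((b ^+ 2)%:C *: T (T x) - B (T (T (B' x)))) x)
      = (l2norm (T (B' x)) <= b * l2norm (T x)).
    rewrite dotBl dotZl BB' !formE -rmorphM -rmorphB ler0c subr_ge0 -exprMn.
    by rewrite ler_pXn2r ?nnegrE ?mulr_ge0 ?l2norm_ge0.
  by split=> le x; have := le x; rewrite /= sqrE.
split=> [vc x|le]; last first.
  by apply: ereal_inf_lbound; exists c => //; split=> //; exact/formP.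
apply/ler_addgt0Pl => e e0.
have n0 : 0 <= l2norm (T x) by exact: l2norm_ge0.
(* [b > c] is within reach of the infimum, and [b |T x|] exceeds [c |T x|] by at
   most [e]; the [+ 1] covers the case [T x = 0]. *)
pose b := c + e / (l2norm (T x) + 1).
have cb : c < b by rewrite ltrDl divr_gt0// ltr_wpDl.
have : (vartheta T B < b%:E)%E by apply: le_lt_trans vc _; rewrite lte_fin.
move=> /ereal_inf_lt[_ [r [r0 /formP-/(_ r0) le] <-]]; rewrite lte_fin => rb.
apply: le_trans (le x) _; apply: (@le_trans _ _ (b * l2norm (T x))).
  by rewrite ler_wpM2r// ltW.
rewrite mulrDl addrC lerD2r mulrAC ler_pdivrMr ?ltr_wpDl// ler_pM2l//; lra.
Qed.

End Hilbert.

(** * Diagonal operators *)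

Lemma conjcM_real (R : realType) (k : R) (z : R[i]) :
  (k%:C * z)^*%C = k%:C * z^*%C.
Proof. by rewrite rmorphM; congr (_ * _); exact: conjc_real. Qed.

Section Diagonal.
Variables (R : realType) (I : choiceType) (m : I -> R) (M : R).
Hypotheses (m_gt0 : forall i, 0 < m i) (m_le : forall i, m i <= M).

Fact diag_l2 (x : l2 R I) : (fun i => (m i)%:C * x i) \in @l2_pred R I.
Proof.
apply/l2_predE; apply: (@abs_summable_le _ _ _ (fun i => M ^+ 2 * sqmod (x i))).
  move=> i; rewrite ger0_norm ?sqmod_ge0// sqmodZ ler_wpM2r ?sqmod_ge0//.
  by apply: lerXn2r; rewrite ?nnegrE ?m_le// ltW// (lt_le_trans _ (m_le i)).
exact/abs_summableZ/(l2_predE _).1/l2P.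
Qed.

Definition diag (x : l2 R I) : l2 R I := L2 (diag_l2 x).

Lemma diagE x i : diag x i = (m i)%:C * x i. Proof. by []. Qed.

Lemma diagZ a x : diag (a *: x) = a *: diag x.
Proof. by apply: l2_ext => i; rewrite !(diagE, l2Z) mulrCA. Qed.

Lemma diag_ebasis i : diag (ebasis R i) = (m i)%:C *: ebasis R i.
Proof.
apply: l2_ext => j; rewrite diagE l2Z /= /delta.
by have [->//|_] := eqVneq j i; rewrite !mulr0.
Qed.

Lemma diag_inj : injective diag.
Proof.
move=> x y xy; apply: l2_ext => i.
have : diag x i = diag y i by rewrite xy.
by rewrite !diagE; apply: mulfI; rewrite (inj_eq (@complexI R)) gt_eqF.
Qed.

Lemma diag_bounded : bounded_op diag.
Proof.
split=> [a x y|].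
  by apply: l2_ext => i; rewrite !(diagE, l2D, l2Z) mulrDr mulrCA.
exists `|M| => x; apply: l2norm_le_pointwise => // i.
rewrite diagE sqmodZ ler_wpM2r ?sqmod_ge0//.
by apply: lerXn2r; rewrite ?nnegrE ?(ltW (m_gt0 i))// (le_trans (m_le i)) ?ler_norm.
Qed.

Lemma diag_selfadjoint x y : dot (diag x) y = dot x (diag y).
Proof.
congr csum; apply/funext => i.
by rewrite !diagE conjcM_real mulrCA mulrA.
Qed.

(** Splitting the weights as [m = sqrt m * sqrt m] turns [<diag x, x>] into the
    squared norm of the family [sqrt (m i) x i]. *)
Lemma diag_positive : positive_op diag.
Proof.
move=> x; pose y i := (Num.sqrt (m i))%:C * x i.
have mE i : m i = Num.sqrt (m i) ^+ 2 by rewrite sqr_sqrtr// ltW.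
have yl2 : y \in @l2_pred R I.
  apply/l2_predE; apply: (@abs_summable_le _ _ _ (fun i => M * sqmod (x i))).
    by move=> i; rewrite ger0_norm ?sqmod_ge0// sqmodZ ler_wpM2r ?sqmod_ge0// -mE.
  exact/abs_summableZ/(l2_predE _).1/l2P.
suff -> : dot (diag x) x = dot (L2 yl2) (L2 yl2) by rewrite dot_self ler0c sqr_ge0.
congr csum; apply/funext => i /=.
by rewrite /y conjcM_real {1}mE rmorphXn; ring.
Qed.

End Diagonal.

(** * Creation and annihilation operators *)

Section Annihilation.
Variables (R : realType) (d : nat) (i : 'I_d).
Implicit Types (x y : fock R d).

Lemma creationE x j v : creation i x (j :: v) = if j == i then x v else 0.
Proof. by []. Qed.

Lemma creation_nil x : creation i x [::] = 0. Proof. by []. Qed.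

Fact annihilation_l2 x : (fun v => x (i :: v)) \in @l2_pred R (seq 'I_d).
Proof.
rewrite in_l2_pred; have := l2P x; rewrite in_l2_pred; apply: le_lt_trans.
rewrite [leRHS]esum_words => [|w]; last by rewrite lee_fin sqmod_ge0.
rewrite (bigD1 i)//= addeCA leeDl// adde_ge0 ?lee_fin ?sqmod_ge0//.
by apply: sume_ge0 => j _; apply: esum_ge0 => w _; rewrite lee_fin sqmod_ge0.
Qed.

(** Removing the first letter [i] is the coordinate form of [S_i^*]. *)
Definition annihilation x : fock R d := L2 (annihilation_l2 x).

Lemma annihilationE x v : annihilation x v = x (i :: v). Proof. by []. Qed.

Lemma creationK x : annihilation (creation i x) = x.
Proof. by apply: l2_ext => v; rewrite annihilationE creationE eqxx. Qed.

Lemma annihilation_ebasis w : annihilation (ebasis R (i :: w)) = ebasis R w.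
Proof. by rewrite -creation_ebasis creationK. Qed.

Lemma dot_creation x y : dot (creation i x) y = dot x (annihilation y).
Proof.
rewrite /dot (@csum_reindex _ _ _ (cons i)).
- by congr csum; apply/funext => v; rewrite /= eqxx.
- by move=> v w [].
- move=> [|j v] /= nj; first by rewrite mul0r.
  case: eqP => [ji|_]; last by rewrite mul0r.
  by have := nj v; rewrite ji eqxx.
Qed.

Lemma dot_annihilation x y : dot (annihilation x) y = dot x (creation i y).
Proof. by rewrite [LHS]dot_conj -dot_creation -dot_conj. Qed.

Lemma creation_isometry x : l2norm (creation i x) = l2norm x.
Proof. by rewrite /l2norm dot_creation creationK. Qed.

Lemma annihilation_contraction x : l2norm (annihilation x) <= l2norm x.
Proof.
rewrite -creation_isometry -[leRHS]mul1r.
apply: l2norm_le_pointwise => // -[|j v]; rewrite expr1n mul1r.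
  by rewrite creation_nil [leLHS](_ : _ = 0) ?sqmod_ge0// /sqmod /= expr0n addr0.
rewrite creationE; case: eqP => [->//|_].
by rewrite [leLHS](_ : _ = 0) ?sqmod_ge0// /sqmod /= expr0n addr0.
Qed.

Lemma creation_bounded : bounded_op (@creation R d i).
Proof.
split=> [a x y|]; last by exists 1 => x; rewrite creation_isometry mul1r.
apply: l2_ext => -[|j v]; rewrite l2D l2Z ?creation_nil ?mulr0 ?addr0//.
by rewrite !creationE; case: eqP => _; rewrite ?mulr0 ?addr0.
Qed.

Lemma annihilation_bounded : bounded_op annihilation.
Proof.
split=> [a x y|]; first exact: l2_ext.
by exists 1 => x; rewrite mul1r annihilation_contraction.
Qed.

Lemma adj_creation : adj (creation i) = annihilation.
Proof. exact: adjE annihilation_bounded dot_creation. Qed.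

End Annihilation.

(** * Necessity *)

Section Necessity.
Variables (R : realType) (d : nat) (c : 'I_d -> R).
Hypothesis c_gt0 : forall i, 0 < c i.
Local Notation s := (\sum_(i < d) (c i) ^- 2).

(** With [p w = <Q e_w, e_w> = |T e_w|^2], the bound on [S_i] tested at [e_(iw)]
    gives [p w <= c_i^2 p (iw)]. Summing [p] by the first letter, the words that
    start with [i] then carry at least [c_i^-2] times the total mass [1], and the
    empty word carries the remaining [p []]. *)
Lemma weight_sum_le (Q T : fock R d -> fock R d) :
    injective_density Q -> positive_sqrt_of Q T ->
    (forall i, (vartheta T (creation i) <= (c i)%:E)%E) ->
  s <= 1 - l2norm (T (vacuum R d)) ^+ 2.
Proof.
move=> [_ _ _ trQ] [bT posT QE] vT.
pose p w := l2norm (T (ebasis R w)) ^+ 2.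
have p0 w : 0 <= p w by exact: sqr_ge0.
have trE : (\esum_(w in [set: seq 'I_d]) (p w)%:E = 1)%E.
  rewrite -trQ /trace; apply: eq_esum => w _; congr EFin.
  rewrite -QE -[(T \o T) _]/(T (T _)).
  by rewrite (positive_op_selfadjoint bT.1 posT) dot_self.
have pS i w : (c i) ^- 2 * p w <= p (i :: w).
  rewrite mulrC ler_pdivrMr ?exprn_gt0// mulrC -exprMn.
  have ci0 := ltW (c_gt0 i); rewrite ler_pXn2r ?nnegrE ?mulr_ge0 ?l2norm_ge0//.
  have [+ _] := vartheta_leP bT posT (annihilation_bounded R i)
    (@dot_creation R d i) (ltW (c_gt0 i)).
  by move=> /(_ (vT i) (ebasis R (i :: w))); rewrite annihilation_ebasis.
rewrite lerBrDr addrC -lee_fin -trE esum_words ?EFinD => [|w]; last by rewrite lee_fin.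
apply: leeD => //; rewrite -sumEFin; apply: lee_sum => i _.
rewrite -[leLHS]mule1 -trE -esumZ_ge0 ?invr_ge0 ?exprn_ge0 ?(ltW (c_gt0 i))//.
by apply: le_esum => w _; rewrite lee_fin.
Qed.

(** Were [T Omega = 0], then [Q Omega = T (T Omega)] would vanish too. *)
Lemma sqrt_vacuum_gt0 (Q T : fock R d -> fock R d) :
  injective_density Q -> positive_sqrt_of Q T -> 0 < l2norm (T (vacuum R d)).
Proof.
move=> [[linQ _] injQ _ _] [bT _ QE]; apply: l2norm_gt0.
have Q0 : Q 0 = 0 by have := linQ (-1) 0 0; rewrite scaler0 add0r scaleN1r addNr.
have T0 : T 0 = 0 by have := bT.1 (-1) 0 0; rewrite scaler0 add0r scaleN1r addNr.
apply/eqP => TO; have : Q (vacuum R d) = Q 0 by rewrite -QE /= TO T0.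
move=> /injQ /(congr1 (fun x : fock R d => x [::])) /=.
by rewrite /delta eqxx => /eqP; rewrite oner_eq0.
Qed.

End Necessity.

(** * The geometric density *)

Section GeometricDensity.
Variables (R : realType) (d : nat) (c : 'I_d -> R).
Local Notation s := (\sum_(i < d) (c i) ^- 2).
Hypotheses (c_gt0 : forall i, 0 < c i) (s_lt1 : s < 1).

Definition sqrt_weight (w : seq 'I_d) : R := Num.sqrt (1 - s) * (word_prod c w)^-1.

Lemma word_prod_gt0 w : 0 < word_prod c w.
Proof. exact: prodr_gt0. Qed.

Lemma scale_ge1 i : 1 <= c i.
Proof.
have : (c i) ^- 2 <= 1.
  apply: le_trans (ltW s_lt1); rewrite (bigD1 i)//= lerDl.
  by apply: sumr_ge0 => j _; rewrite invr_ge0 exprn_ge0// (ltW (c_gt0 j)).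
rewrite invf_le1 ?exprn_gt0//; apply: contraTT; rewrite -!ltNge => ci.
by rewrite expr_lt1// (ltW (c_gt0 i)).
Qed.

Lemma sqrt_weight_gt0 w : 0 < sqrt_weight w.
Proof. by rewrite mulr_gt0 ?invr_gt0 ?word_prod_gt0// sqrtr_gt0 subr_gt0. Qed.

Lemma sqrt_weight_cons i w : c i * sqrt_weight (i :: w) = sqrt_weight w.
Proof.
rewrite /sqrt_weight /word_prod big_cons invfM mulrCA; congr (_ * _).
by rewrite mulVKf// gt_eqF.
Qed.

Lemma sqrt_weight_le w : sqrt_weight w <= Num.sqrt (1 - s).
Proof.
elim: w => [|i w IHw]; first by rewrite /sqrt_weight /word_prod big_nil invr1 mulr1.
apply: le_trans IHw; rewrite -(sqrt_weight_cons i w) ler_peMl ?scale_ge1//.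
exact/ltW/sqrt_weight_gt0.
Qed.

Definition sqrt_density : fock R d -> fock R d := diag sqrt_weight_gt0 sqrt_weight_le.
Definition density : fock R d -> fock R d := sqrt_density \o sqrt_density.
Local Notation T := sqrt_density.

Lemma sqrt_weight_sqr w : sqrt_weight w ^+ 2 = (1 - s) * (word_prod c w) ^- 2.
Proof. by rewrite exprMn exprVn sqr_sqrtr// subr_ge0 ltW. Qed.

Lemma sqrt_densityZ a x : T (a *: x) = a *: T x. Proof. exact: diagZ. Qed.

Lemma sqrt_density_ebasis w : T (ebasis R w) = (sqrt_weight w)%:C *: ebasis R w.
Proof. exact: diag_ebasis. Qed.

Lemma density_ebasis w :
  density (ebasis R w) = ((1 - s) * (word_prod c w) ^- 2)%:C *: ebasis R w.
Proof.
rewrite /density /= sqrt_density_ebasis sqrt_densityZ sqrt_density_ebasis scalerA.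
by rewrite -rmorphM -expr2 sqrt_weight_sqr.
Qed.

Lemma sqrt_density_inj : injective T. Proof. exact: diag_inj. Qed.

Lemma density_sqrt : positive_sqrt_of density T.
Proof. by split; [exact: diag_bounded|exact: diag_positive|]. Qed.

Lemma dot_density_ebasis w :
  dot (density (ebasis R w)) (ebasis R w) = ((1 - s) * (word_prod c w) ^- 2)%:C.
Proof. by rewrite density_ebasis dotZl dot_ebasis /= /delta eqxx mulr1. Qed.

Lemma density_trace : trace density = 1%E.
Proof.
have r0 i : 0 <= (c i) ^- 2 by rewrite invr_ge0 exprn_ge0// (ltW (c_gt0 i)).
rewrite /trace (eq_esum (b := fun w =>
    ((1 - s) * word_prod (fun i => (c i) ^- 2) w)%:E)); last first.
  move=> w _; rewrite dot_density_ebasis /=; congr (_ * _)%:E.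
  by rewrite /word_prod prodfV prodrXl.
rewrite esumZ_ge0 ?subr_ge0 ?(ltW s_lt1)// => [|w]; last exact: prodr_ge0.
by rewrite esum_word_prod// -EFinM mulfV// gt_eqF// subr_gt0.
Qed.

Lemma density_injective_density : injective_density density.
Proof.
split; last exact: density_trace.
- by apply: bounded_op_comp; exact: diag_bounded.
- by apply: inj_comp; exact: sqrt_density_inj.
- by move=> x; rewrite /density /= diag_selfadjoint dot_self ler0c sqr_ge0.
Qed.

(** Prefixing the letter [i] divides the weight by [c_i], so [T] commutes with
    the creation and annihilation operators up to a scalar; these scalars give
    both [Theta] and the bounds on [vartheta]. *)
Lemma sqrt_density_creation i x :
  T (creation i x) = ((c i)^-1)%:C *: creation i (T x).
Proof.
apply: l2_ext => -[|j v]; first by rewrite diagE l2Z !creation_nil !mulr0.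
rewrite diagE l2Z !creationE; case: eqP => [->|_]; last by rewrite !mulr0.
rewrite diagE -(sqrt_weight_cons i v) mulrA -rmorphM; congr (_%:C * _).
by rewrite mulKf// gt_eqF.
Qed.

Lemma sqrt_density_annihilation i x :
  T (annihilation i x) = (c i)%:C *: annihilation i (T x).
Proof.
apply: l2_ext => v; rewrite l2Z annihilationE !diagE annihilationE.
by rewrite mulrA -rmorphM sqrt_weight_cons.
Qed.

Lemma Theta_creation i : Theta T (creation i) = (fun x => (c i)%:C *: creation i x).
Proof.
apply: ThetaE => [||x]; first exact: sqrt_density_inj.
  exact/bounded_opZ/creation_bounded.
rewrite sqrt_densityZ sqrt_density_creation scalerA -rmorphM mulfV ?scale1r//.
by rewrite gt_eqF.
Qed.

Lemma Theta_annihilation i :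
  Theta T (annihilation i) = (fun x => ((c i)^-1)%:C *: annihilation i x).
Proof.
apply: ThetaE => [||x]; first exact: sqrt_density_inj.
  exact/bounded_opZ/annihilation_bounded.
rewrite sqrt_densityZ sqrt_density_annihilation scalerA -rmorphM mulVf ?scale1r//.
by rewrite gt_eqF.
Qed.

Let vartheta_creationP i b : 0 <= b ->
  (vartheta T (creation i) <= b%:E)%E <->
  forall x, l2norm (T (annihilation i x)) <= b * l2norm (T x).
Proof.
have [bT posT _] := density_sqrt.
exact: vartheta_leP bT posT (annihilation_bounded R i) (@dot_creation R d i).
Qed.

Lemma vartheta_creation_le i : (vartheta T (creation i) <= (c i)%:E)%E.
Proof.
apply/vartheta_creationP => [|x]; first exact/ltW.
rewrite sqrt_density_annihilation.
by rewrite l2normZ gtr0_norm// ler_pM2l// annihilation_contraction.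
Qed.

(** The bound is sharp on the pair [Omega] and [S_i Omega], whose weights for
    [T^2] have ratio [c_i^2]. *)
Lemma vartheta_creation i : vartheta T (creation i) = (c i)%:E.
Proof.
apply/eqP; rewrite eq_le vartheta_creation_le/=.
have : (0 <= vartheta T (creation i))%E.
  by apply: le_ereal_inf_tmp => _ [b [b0 _] <-]; rewrite lee_fin.
have := vartheta_creation_le i.
case vE : (vartheta T (creation i)) => [b||] //; rewrite !lee_fin => _ b0.
have /(vartheta_creationP i b0)/(_ (ebasis R [:: i])) :
    (vartheta T (creation i) <= b%:E)%E.
  by rewrite vE.
rewrite annihilation_ebasis !sqrt_density_ebasis !l2normZ !l2norm_ebasis !mulr1.
by rewrite !gtr0_norm ?sqrt_weight_gt0// -(sqrt_weight_cons i) ler_pM2r ?sqrt_weight_gt0.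
Qed.

Lemma vartheta_annihilation_le i : (vartheta T (annihilation i) <= (c i)%:E)%E.
Proof.
have [bT posT _] := density_sqrt.
have [_ +] := vartheta_leP bT posT (creation_bounded R i)
  (@dot_annihilation R d i) (ltW (c_gt0 i)).
apply=> x; rewrite sqrt_density_creation l2normZ creation_isometry.
rewrite ler_wpM2r ?l2norm_ge0// gtr0_norm ?invr_gt0//.
by apply: le_trans (scale_ge1 i); rewrite invf_le1 ?scale_ge1.
Qed.

Lemma Lambda_creation i : Lambda T (creation i) = (c i)%:E.
Proof.
rewrite /Lambda adj_creation vartheta_creation.
rewrite [X in maxe _ X]max_l ?vartheta_annihilation_le// max_r//.
apply: ge_ereal_sup => _ [x /= x1 <-]; rewrite lee_fin creation_isometry.
exact: le_trans x1 (scale_ge1 i).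
Qed.

End GeometricDensity.

Theorem theoremA1 (R : realType) (d : nat) (c : 'I_d -> R)
    (hd : (2 <= d)%N) (hc : forall i, 0 < c i) :
  let s : R := \sum_(i < d) (c i) ^- 2 in
  let Omega : fock R d := vacuum R d in
  [/\ (exists Q T : fock R d -> fock R d,
         [/\ injective_density Q, positive_sqrt_of Q T
           & forall i, (vartheta T (creation i) <= (c i)%:E)%E])
       <-> s < 1,
      forall a : R, 0 < a < 1 ->
       ((exists Q T : fock R d -> fock R d,
         [/\ injective_density Q, positive_sqrt_of Q T,
             forall i, (vartheta T (creation i) <= (c i)%:E)%E
           & a%:C <= dot (Q Omega) Omega])
        <-> s <= 1 - a)
    & s < 1 ->
      exists Q T : fock R d -> fock R d,
      [/\ bounded_op Q,
          forall w, Q (ebasis R w) = ((1 - s) * (word_prod c w) ^- 2)%:C *: ebasis R w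
        & positive_sqrt_of Q T] /\
      [/\ injective_density Q,
          forall i, (vartheta T (creation i) <= (c i)%:E)%E,
          forall a : R, 0 < a < 1 -> s <= 1 - a -> a%:C <= dot (Q Omega) Omega
        & forall i,
            [/\ Theta T (creation i) = (fun x => (c i)%:C *: creation i x),
                Theta T (adj (creation i))
                = (fun x => ((c i)^-1)%:C *: adj (creation i) x)
              & Lambda T (creation i) = (c i)%:E]]].
Proof.
move=> s Omega.
have s_le Q T : injective_density Q -> positive_sqrt_of Q T ->
    (forall i, (vartheta T (creation i) <= (c i)%:E)%E) ->
    s <= 1 - l2norm (T Omega) ^+ 2 by exact: weight_sum_le.
have vacuumE (s1 : s < 1) : dot (density hc s1 Omega) Omega = (1 - s)%:C.
  by rewrite dot_density_ebasis /word_prod big_nil expr1n invr1 mulr1.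
split=> [|a /andP[a0 a1]|s1].
- split=> [[Q [T [dQ QT vT]]]|s1].
    apply: le_lt_trans (s_le _ _ dQ QT vT) _.
    by rewrite ltrBlDr ltrDl exprn_gt0// (sqrt_vacuum_gt0 dQ QT).
  exists (density hc s1), (sqrt_density hc s1); split.
  + exact: density_injective_density.
  + exact: density_sqrt.
  + exact: vartheta_creation_le.
- split=> [[Q [T [dQ QT vT aQ]]]|sa].
    apply: le_trans (s_le _ _ dQ QT vT) _; rewrite lerD2l lerN2.
    have [bT posT QE] := QT.
    rewrite -lecR -dot_self -(positive_op_selfadjoint bT.1 posT).
    by rewrite -[T (T _)]/((T \o T) _) QE.
  have s1 : s < 1 by apply: le_lt_trans sa _; rewrite ltrBlDr ltrDl.
  exists (density hc s1), (sqrt_density hc s1); split.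
  + exact: density_injective_density.
  + exact: density_sqrt.
  + exact: vartheta_creation_le.
  + by rewrite vacuumE lecR lerBrDl addrC -lerBrDl.
- exists (density hc s1), (sqrt_density hc s1); split; split.
  + by case: (density_injective_density hc s1).
  + exact: density_ebasis.
  + exact: density_sqrt.
  + exact: density_injective_density.
  + exact: vartheta_creation_le.
  + by move=> a _ sa; rewrite vacuumE lecR lerBrDl addrC -lerBrDl.
  + move=> i; rewrite adj_creation; split.
    * exact: Theta_creation.
    * exact: Theta_annihilation.
    * exact: Lambda_creation.
Qed.
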